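(* Let $N,d\ge 1$ be integers. For $j,k=1,\dots,N$ let $u_{jk},u_{jk}^{*}:[0,+\infty)\to[0,+\infty)$ be Lebesgue integrable on compact intervals. Let $(t_n)_{n\in\mathbb N}\subset[0,+\infty)$ be a sequence with $t_n\to+\infty$ such that, for each $j,k=1,\dots,N$, the functions $t\mapsto u_{jk}(t_n+t)$ satisfy $u_{jk}(t_n+\cdot)\overset{\ast}{\rightharpoonup}u_{jk}^{*}$ as $n\to\infty$. Let $G$ be the directed graph with nodes $\{1,\dots,N\}$ in which there is an arrow from node $j$ to node $k$ if $$\int_{t}^{+\infty}u_{jk}^{*}(s)\,ds>0\qquad\text{for all } t>0 .$$ Assume that $G$ has a globally reachable node. Then, for every initial configuration $(x_1(0),\dots,x_N(0))\in(\mathbb R^d)^N$, the solution of $$\dot x_j=\sum_{k=1}^{N}u_{jk}(t)\,(x_k-x_j),\qquad j=1,\dots,N,$$ converges to consensus.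
   Context: Convergence $\overset{\ast}{\rightharpoonup}$: for $f_n,f:[0,+\infty)\to[0,+\infty)$ Lebesgue integrable on compact intervals, $f_n\overset{\ast}{\rightharpoonup}f$ means $\lim_{n\to\infty}\int_a^b f_n=\int_a^b f$ for all bounded intervals $[a,b]\subset[0,+\infty)$. Globally reachable node: a node $\ell^*$ of a directed graph is globally reachable if for every node $i$ there is a directed path of arrows $i\to j_1\to\dots\to\ell^*$. Solutions are in the Carathéodory sense: $x_j:[0,+\infty)\to\mathbb R^d$ is absolutely continuous on compact intervals and the equation holds for almost every $t$. Consensus: a solution converges to consensus if there exists $x^*\in\mathbb R^d$ with $\lim_{t\to+\infty}x_j(t)=x^*$ for all $j=1,\dots,N$. *)

(* Defs.v *)
From HB Require Import structures.
From mathcomp Require Import all_boot all_order all_algebra.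
From mathcomp Require Import all_classical all_reals all_analysis.
Set Implicit Arguments.
Unset Strict Implicit.
Unset Printing Implicit Defensive.
Import Order.TTheory GRing.Theory Num.Theory.
Import numFieldNormedType.Exports.
Local Open Scope classical_set_scope.
Local Open Scope ring_scope.

(* MathComp-Analysis, over an arbitrary R : realType. Functions on [0, +oo) are
   total functions on R whose values at negative arguments are never used.
   completed_lebesgue_measure lives on the Lebesgue sigma-algebra, whereas
   lebesgue_measure is its restriction to the Borel sets and would only allow
   Borel measurable coefficients. *)

Definition nneg_locally_integrable (R : realType) (f : R -> R) : Prop :=
  (forall t : R, 0 <= t -> 0 <= f t) /\
  (forall a b : R, 0 <= a -> a <= b ->
    (@completed_lebesgue_measure R).-integrable `[a, b] (EFin \o f)).

(* Rintegral is the real part of the extended-real integral; the two agree when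
   f and every f_ n satisfy nneg_locally_integrable. *)
Definition weak_star_cvg (R : realType) (f_ : nat -> R -> R) (f : R -> R)
    : Prop :=
  forall a b : R, 0 <= a -> a <= b ->
    (\int[@completed_lebesgue_measure R]_(s in `[a, b]) f_ n s)
      @[n --> \oo] --> \int[@completed_lebesgue_measure R]_(s in `[a, b]) f s.

(* The integral is extended-real valued, possibly +oo. *)
Definition persistent_arrow (R : realType) (N : nat) (u : 'I_N -> 'I_N -> R -> R)
    (j k : 'I_N) : Prop :=
  forall t : R, 0 < t ->
    (0 < \int[@completed_lebesgue_measure R]_(s in `[t, +oo[) (u j k s)%:E)%E.

Definition persistent_graph (R : realType) (N : nat)
    (u : 'I_N -> 'I_N -> R -> R) : rel 'I_N :=
  fun j k => `[< persistent_arrow u j k >].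

(* connect is reflexive-transitive: a node reaches itself by the empty path. *)
Definition globally_reachable (T : finType) (e : rel T) (l : T) : Prop :=
  forall i : T, connect e i l.

Definition absolutely_continuous_on (R : realType) (V : normedModType R)
    (a b : R) (f : R -> V) : Prop :=
  forall e : R, 0 < e -> exists2 d : R, 0 < d &
    forall (n : nat) (A B : 'I_n -> R),
      (forall i, a <= A i /\ A i <= B i /\ B i <= b) ->
      trivIset [set: 'I_n] (fun i => `]A i, B i[%classic) ->
      \sum_(i < n) (B i - A i) < d ->
      \sum_(i < n) `|f (B i) - f (A i)| < e.

(* Restricting the equation to t > 0 only drops the null set {0}, where the
   two-sided derivative would involve values of x at negative times. *)
Definition caratheodory_solution (R : realType) (N d : nat)
    (u : 'I_N -> 'I_N -> R -> R) (x : 'I_N -> R -> 'rV[R]_d) : Prop :=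
  forall j : 'I_N,
    (forall a b : R, 0 <= a -> a <= b -> absolutely_continuous_on a b (x j)) /\
    {ae @completed_lebesgue_measure R, forall t : R, 0 < t ->
      is_derive t 1 (x j) (\sum_(k < N) u j k t *: (x k t - x j t))}.

Definition converges_to_consensus (R : realType) (N d : nat)
    (x : 'I_N -> R -> 'rV[R]_d) : Prop :=
  exists xstar : 'rV[R]_d, forall j : 'I_N, x j t @[t --> +oo] --> xstar.

(* Main.v *)
Require Import Defs.
From HB Require Import structures.
From mathcomp Require Import all_boot all_order all_algebra.
From mathcomp Require Import all_classical all_reals all_analysis.
From mathcomp Require Import measurable_realfun ring lra.
Set Implicit Arguments.
Unset Strict Implicit.
Unset Printing Implicit Defensive.
Import Order.TTheory GRing.Theory Num.Theory.
Import numFieldNormedType.Exports.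
Local Open Scope classical_set_scope.
Local Open Scope ring_scope.

(* Let U_jk be a primitive of u_jk and V_jk one of u*_jk. If w >= 0 solves the
   system on [s, t] and w_k >= a there, then
     exp (sum_i (U_ji t - U_ji s)) * w_j t >= w_j s + a * (U_jk t - U_jk s),
   because (exp (sum_i U_ji) * w_j)' = exp (sum_i U_ji) * sum_i u_ji * w_i. The
   increments of U over t_n + [a, b] converge to those of V over [a, b], so along
   a path of persistent arrows from j to the globally reachable node l this
   gives T and c > 0, independent of n and w, with
   w_j (t_n + T) >= c * w_l t_n for n large. If all agents lie in [lo, hi] at
   time t_n they stay there afterwards (maximum principle); applying the bound to
   w = hi - x and w = x - lo shows that at time t_n + T they lie in an interval
   of length (1 - c) * (hi - lo), and iterating yields consensus, coordinate by
   coordinate.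

   An absolutely continuous function whose derivative is nonnegative almost
   everywhere is nondecreasing, so differential inequalities can be integrated
   without representing solutions as integrals. Each u_jk is replaced by a Borel
   function equal to it almost everywhere in order to use Lebesgue
   differentiation. *)

(** * Absolutely continuous functions *)

(** Let [c] be the supremum of the points up to which [P] holds throughout. Closure from the left
    gives [P c], and if [c < b], extension to the right contradicts the choice of [c]. *)
Lemma real_induction (R : realType) (a b : R) (P : R -> Prop) :
  a <= b -> P a ->
  (forall t, a <= t -> t < b -> P t ->
    exists2 d, 0 < d & forall s, t < s -> s <= b -> s < t + d -> P s) ->
  (forall t, a < t -> t <= b -> (forall s, a <= s -> s < t -> P s) -> P t) ->
  P b.
Proof.
move=> ab Pa Pright Pleft.
pose S := [set t | a <= t /\ t <= b /\ forall s, a <= s -> s <= t -> P s].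
have Sa : S a.
  by split=> //; split=> // s as_ sa; rewrite (@le_anti _ _ s a) // sa as_.
have Sb : ubound S b by move=> t [_ []].
have hS : has_sup S by split; [exists a | exists b].
set c := sup S.
have ac : a <= c by apply: sup_upper_bound.
have cb : c <= b by apply: ge_sup => //; exists a.
have below s : a <= s -> s < c -> P s.
  move=> as_ sc; have [t [_ [_ Pt]] st] := sup_gt (ex_intro _ a Sa) sc.
  by apply: Pt => //; exact: ltW.
have Pc : P c.
  have [<- //|a_neq_c] := eqVneq a c.
  by apply: Pleft => //; rewrite lt_neqAle a_neq_c.
have [<- //|c_neq_b] := eqVneq c b.
have cltb : c < b by rewrite lt_neqAle c_neq_b.
have [d d0 Pd] := Pright c ac cltb Pc.
pose e := Num.min b (c + d / 2).
have ce : c < e by rewrite lt_min cltb /= ltrDl divr_gt0.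
have Se : S e.
  split; first exact: le_trans ac (ltW ce).
  split; first by rewrite ge_min lexx.
  move=> s as_ se; have [sc|cs|->//] := ltgtP s c; first exact: below.
  apply: Pd => //; first by rewrite (le_trans se) // ge_min lexx.
  apply: (le_lt_trans se); rewrite gt_min; apply/orP; right.
  by rewrite ltrD2l ltr_pdivrMr // mulr_natr mulr2n ltrDl.
by have := sup_upper_bound hS Se; rewrite leNgt ce.
Qed.

Definition fun_rcons (T : Type) (n : nat) (A : 'I_n -> T) (x : T) (i : 'I_n.+1) : T :=
  if unlift ord_max i is Some j then A j else x.

Lemma fun_rcons_max (T : Type) n (A : 'I_n -> T) x :
  fun_rcons A x ord_max = x.
Proof. by rewrite /fun_rcons unlift_none. Qed.

Lemma fun_rcons_lift (T : Type) n (A : 'I_n -> T) x i :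
  fun_rcons A x (lift ord_max i) = A i.
Proof. by rewrite /fun_rcons liftK. Qed.

(* In the proof of [ac_nonincreasing], [U] is an open neighbourhood of small
   measure of the exceptional null set, so that these sums are small. *)
Definition variation_sums (R : realType) (f : R -> R) (U : set R) (a t : R) :
    set R :=
  [set v | exists n (A B : 'I_n -> R),
    [/\ forall i, a <= A i /\ A i <= B i /\ B i <= t,
        trivIset [set: 'I_n] (fun i => `]A i, B i[%classic),
        forall i, `]A i, B i[%classic `<=` U
      & v = \sum_(i < n) `|f (B i) - f (A i)|]].

Lemma variation_sums0 (R : realType) (f : R -> R) (U : set R) (a t : R) :
  variation_sums f U a t 0.
Proof.
exists 0%N, (fun=> 0), (fun=> 0); split=> [[]//||[]//|]; last by rewrite big_ord0.
by move=> [].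
Qed.

(** The interval []t, s[] lies to the right of all earlier ones, which end at [t] at the latest, so
    appending it keeps the family disjoint. *)
Lemma variation_sums_extend (R : realType) (f : R -> R) (U : set R) (a t s v : R) :
  a <= t -> t <= s -> `]t, s[%classic `<=` U ->
  variation_sums f U a t v -> variation_sums f U a s (v + `|f s - f t|).
Proof.
move=> at_ ts tsU [n [A [B [AB dAB ABU ->]]]].
exists n.+1, (fun_rcons A t), (fun_rcons B s); split.
- move=> i; case: (unliftP ord_max i) => [j|] ->.
    rewrite !fun_rcons_lift; have [? [? Bt]] := AB j.
    by split=> //; split=> //; exact: le_trans ts.
  by rewrite !fun_rcons_max.
- have disj (j : 'I_n) : `]A j, B j[ `&` `]t, s[ = set0 :> set R.
    apply/seteqP; split=> // x [] /=; rewrite !in_itv /= => /andP[_ xB] /andP[tx _].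
    by have [_ [_ Bt]] := AB j; have := lt_trans (lt_le_trans xB Bt) tx; rewrite ltxx.
  apply/trivIsetP => i k _ _.
  case: (unliftP ord_max i) => [i'|] ->; case: (unliftP ord_max k) => [k'|] ->;
    rewrite ?fun_rcons_lift ?fun_rcons_max ?eqxx // => ik.
    by move/trivIsetP : dAB; apply => //; apply: contra_neq ik => ->.
  by rewrite setIC.
- move=> i; case: (unliftP ord_max i) => [j|] ->.
    by rewrite !fun_rcons_lift.
  by rewrite !fun_rcons_max.
- rewrite big_ord_recr /= !fun_rcons_max; congr (_ + _).
  apply: eq_bigr => i _.
  have -> : widen_ord (leqnSn n) i = lift ord_max i by apply: val_inj; exact: esym (lift_max i).
  by rewrite !fun_rcons_lift.
Qed.

Lemma variation_sumsS (R : realType) (f : R -> R) (U : set R) (a t s : R) :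
  t <= s -> variation_sums f U a t `<=` variation_sums f U a s.
Proof.
move=> ts v [n [A [B [AB ? ? ?]]]]; exists n, A, B; split=> // i.
by have [? [? Bt]] := AB i; split=> //; split=> //; exact: le_trans ts.
Qed.

(** The first hypothesis is the clause of absolute continuity for given [e] and [d]. It applies
    because disjoint intervals inside [U] have total length at most the measure of [U]. *)
Lemma variation_sums_lt (R : realType) (f : R -> R) (U : set R) (a b t e d v : R) :
  (forall (n : nat) (A B : 'I_n -> R),
      (forall i, a <= A i /\ A i <= B i /\ B i <= b) ->
      trivIset [set: 'I_n] (fun i => `]A i, B i[%classic) ->
      \sum_(i < n) (B i - A i) < d ->
      \sum_(i < n) `|f (B i) - f (A i)| < e) ->
  open U -> (@lebesgue_measure R U < d%:E)%E -> t <= b ->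
  variation_sums f U a t v -> v < e.
Proof.
move=> acf oU Ud tb [n [A [B [AB dAB ABU ->]]]].
apply: acf => // [i|]; first by have [? [? ?]] := AB i; split=> //; split=> //; exact: le_trans tb.
rewrite -lte_fin; apply: le_lt_trans Ud.
have -> : ((\sum_(i < n) (B i - A i))%:E =
    \sum_(i < n) @lebesgue_measure R `]A i, B i[%classic)%E.
  rewrite -sumEFin; apply: eq_bigr => i _; rewrite lebesgue_measure_itv /= lte_fin.
  have [_ [+ _]] := AB i; rewrite le_eqVlt => /orP[/eqP ->|->//].
  by rewrite subrr ltxx.
rewrite -(@measure_bigsetU_ord _ _ _ (@lebesgue_measure R) _ xpredT (fun i => `]A i, B i[%classic)) //.
apply: le_measure; rewrite ?inE.
- by apply: bigsetU_measurable => i _; exact: measurable_itv.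
- exact: open_measurable.
- by elim/big_ind: _ => // X Y XU YU; rewrite subUset; split.
Qed.

Lemma ac_unif (R : realType) (V : normedModType R) (f : R -> V) (a b e : R) :
  absolutely_continuous_on a b f -> 0 < e ->
  exists2 d, 0 < d & forall s t, a <= s -> s <= t -> t <= b -> t - s < d ->
    `|f t - f s| < e.
Proof.
move=> acf e0; have [d d0 fd] := acf e e0; exists d => // s t as_ st tb tsd.
have := fd 1%N (fun=> s) (fun=> t); rewrite !big_ord1; apply=> //.
by apply/trivIsetP => i j _ _; rewrite (ord1 i) (ord1 j) eqxx.
Qed.

(** Steps shorter than [d] change [f] by less than 1, so real induction propagates the existence of
    a bound, raising it by 1 at each extension. *)
Lemma ac_bounded (R : realType) (V : normedModType R) (f : R -> V) (a b : R) :
  a <= b -> absolutely_continuous_on a b f ->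
  exists2 M, 0 <= M & forall t, a <= t -> t <= b -> `|f t| <= M.
Proof.
move=> ab acf; have [d d0 fd] := ac_unif acf ltr01.
suff [M Mf] : exists M, forall t, a <= t -> t <= b -> `|f t| <= M.
  by exists M => //; apply: le_trans (Mf a _ _).
have step M s t : a <= s -> s <= t -> t <= b -> t - s < d -> `|f s| <= M ->
    `|f t| <= M + 1.
  move=> as_ st tb tsd fsM; rewrite -(subrK (f s) (f t)) (le_trans (ler_normD _ _)) //.
  by rewrite addrC lerD // ltW // fd.
pose P c := exists M, forall t, a <= t -> t <= b -> t <= c -> `|f t| <= M.
suff [M Mf] : P b by exists M => t ? tb; exact: Mf.
apply: (@real_induction R a b P) => //.
- exists `|f a| => t ta _ ta'; suff -> : t = a by [].
  by apply/eqP; rewrite eq_le ta ta'.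
- move=> c ac cb [M Mc]; exists d => // s cs sb scd.
  exists (M + 1) => t at_ tb ts; have [tc|ct] := leP t c.
    by rewrite (le_trans (Mc _ _ _ _)) // lerDl.
  apply: (step M c) => //; first exact: ltW.
    by rewrite ltrBlDl (le_lt_trans ts).
  by apply: Mc => //; exact: ltW.
- move=> c ac cb Pc; pose s := Num.max a (c - d / 2).
  have sc : s < c by rewrite gt_max ac /= gtrBl divr_gt0.
  have as_ : a <= s by rewrite le_max lexx.
  have [M Ms] := Pc s as_ sc; exists (M + 1) => t at_ tb tc.
  have [ts|st] := leP t s; first by rewrite (le_trans (Ms _ _ _ _)) // lerDl.
  apply: (step M s) => //; first exact: ltW.
    rewrite ltrBlDl (le_lt_trans tc) // -ltrBlDr.
    rewrite lt_max; apply/orP; right; rewrite ltrD2l ltrN2.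
    by rewrite ltr_pdivrMr // mulr_natr mulr2n ltrDl.
  by apply: Ms => //; apply: le_trans cb; exact: ltW.
Qed.

(** Sums, products, exponentials, maxima and coordinates all inherit absolute continuity through
    this criterion, which leaves only an estimate on increments. *)
Lemma ac_dominated (R : realType) (V1 V2 V : normedModType R) (a b C : R)
    (f : R -> V) (g : R -> V1) (h : R -> V2) :
  (forall s t, a <= s -> s <= t -> t <= b ->
     `|f t - f s| <= C * (`|g t - g s| + `|h t - h s|)) ->
  absolutely_continuous_on a b g -> absolutely_continuous_on a b h ->
  absolutely_continuous_on a b f.
Proof.
move=> fgh acg ach e e0; pose C1 := Num.max C 1.
have C1_gt0 : 0 < C1 by rewrite lt_max ltr01 orbT.
have e1_gt0 : 0 < e / C1 / 2 by rewrite !divr_gt0.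
have [d1 d1_gt0 gd] := acg _ e1_gt0; have [d2 d2_gt0 hd] := ach _ e1_gt0.
exists (Num.min d1 d2); first by rewrite lt_min d1_gt0.
move=> n A B AB dAB; rewrite lt_min => /andP[ABd1 ABd2].
apply: (@le_lt_trans _ _ (C1 * (\sum_(i < n) `|g (B i) - g (A i)| +
    \sum_(i < n) `|h (B i) - h (A i)|))).
  rewrite -big_split mulr_sumr /=; apply: ler_sum => i _; have [? [? ?]] := AB i.
  rewrite (le_trans (fgh _ _ _ _ _)) // ler_wpM2r ?addr_ge0 //.
  by rewrite le_max lexx.
rewrite mulrC -ltr_pdivlMr // (splitr (e / C1)) ltrD //.
- exact: gd.
- exact: hd.
Qed.

(* Real induction on [f t - f a <= e * (t - a) + sup (S t)]: off the null set the
   derivative bound extends the inequality to the right, on it the variation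
   inside [U] absorbs the increment of [f]. *)
Lemma ac_nonincreasing (R : realType) (a b : R) (f : R -> R) :
  a <= b -> absolutely_continuous_on a b f ->
  {ae @lebesgue_measure R, forall t, a < t -> t < b ->
    forall e : R, 0 < e -> \forall h \near 0^'+, f (t + h) - f t <= e * h} ->
  f b <= f a.
Proof.
move=> ab acf fae; apply/ler_addgt0Pr => e0 e0_gt0.
(* Chosen so that [e * (b - a) + e = e0]: the first summand is the error in slope, the second bounds
   the variation sums. *)
pose e := e0 / (1 + (b - a)).
have ba1 : 0 < 1 + (b - a) by rewrite ltr_pwDl // subr_ge0.
have e_gt0 : 0 < e by rewrite divr_gt0.
have [d d_gt0 fd] := acf e e_gt0.
pose P t := a < t -> t < b ->
  forall e : R, 0 < e -> \forall h \near 0^'+, f (t + h) - f t <= e * h.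
(* The point [a] counts as exceptional because the derivative bound is assumed for [a < t] only; the
   induction leaves [a] by means of the variation sums. *)
have negE : (@lebesgue_measure R).-negligible (~` [set t | P t] `|` [set a]).
  apply: negligibleU; first exact: fae.
  by exists [set a]; split => //; exact: lebesgue_measure_set1.
have /negligible_outer_measure E0 := negE.
have d2_gt0 : 0 < d / 2 by rewrite divr_gt0.
have [U [oU EU]] := outer_measure_open_le (~` [set t | P t] `|` [set a]) d2_gt0.
rewrite E0 add0e => Ud2.
have Ud : (@lebesgue_measure R U < d%:E)%E.
  by rewrite (le_lt_trans Ud2) // lte_fin ltr_pdivrMr // mulr_natr mulr2n ltrDl.
pose S t := variation_sums f U a t.
have Sub t : t <= b -> ubound (S t) e.
  by move=> tb v Stv; apply/ltW/(variation_sums_lt fd oU Ud tb Stv).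
have hS t : t <= b -> has_sup (S t).
  by move=> tb; split; [exists 0; exact: variation_sums0 | exists e; exact: Sub].
pose Q t := f t - f a <= e * (t - a) + sup (S t).
suff Qb : Q b.
  have : sup (S b) <= e by apply: ge_sup; [exists 0; exact: variation_sums0|exact: Sub].
  have -> : e0 = e * (b - a) + e by rewrite /e; field; rewrite gt_eqF.
  by move: Qb; rewrite /Q; lra.
have Smono s t : s <= t -> t <= b -> sup (S s) <= sup (S t).
  move=> st tb; apply: ge_sup; first by exists 0; exact: variation_sums0.
  by move=> v Ssv; apply: sup_upper_bound; [exact: hS|exact: variation_sumsS Ssv].
apply: (@real_induction R a b Q) => //.
- rewrite /Q !subrr mulr0 add0r; apply: sup_upper_bound; first exact: hS.
  exact: variation_sums0.
- move=> t at_ tb Qt; have [tE|tNE] := pselect ((~` [set t | P t] `|` [set a]) t).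
    have [r /= r0 rU] : nbhs t U by apply: open_nbhs_nbhs; split=> //; exact: EU.
    exists r => // s ts sb str.
    have Sext v : S t v -> S s (v + `|f s - f t|).
      apply: variation_sums_extend => //; first exact: ltW.
      move=> x /=; rewrite in_itv /= => /andP[tx xs]; apply: rU => /=.
      by rewrite distrC gtr0_norm ?subr_gt0 // ltrBlDl (lt_trans xs).
    have : sup (S t) <= sup (S s) - `|f s - f t|.
      apply: ge_sup; first by exists 0; exact: variation_sums0.
      move=> v Stv; rewrite lerBrDr; apply: sup_upper_bound; first exact: hS.
      exact: Sext.
    have := ler_norm (f s - f t).
    have : e * (t - a) <= e * (s - a) by rewrite ler_pM2l // lerD2r ltW.
    by move: Qt; rewrite /Q; lra.
  have {}at_ : a < t.
    rewrite lt_neqAle at_ andbT; apply/eqP => at'.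
    by apply: tNE; right; rewrite /= at'.
  have Pt : P t by apply: contrapT => nPt; apply: tNE; left.
  have := Pt at_ tb e e_gt0.
  rewrite near_withinE => -[r /= r0 rP]; exists r => // s ts sb str.
  have := rP (s - t); rewrite /= sub0r normrN gtr0_norm ?subr_gt0 //.
  rewrite ltrBlDl => /(_ str ts); rewrite (addrC t) subrK => fst.
  have := Smono t s (ltW ts) sb.
  by move: Qt; rewrite /Q; nra.
(* Uniform continuity transfers the inequality to [t] from a nearby [s < t], up to an arbitrarily
   small [z]. *)
- move=> t at_ tb Qlt; rewrite /Q; apply/ler_addgt0Pr => z z0.
  have [r r0 rf] := ac_unif acf z0.
  pose s := Num.max a (t - r / 2).
  have st : s < t by rewrite gt_max at_ /= gtrBl divr_gt0.
  have as_ : a <= s by rewrite le_max lexx.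
  have := Qlt s as_ st; rewrite /Q.
  have := Smono s t (ltW st) tb.
  have ts : t - s < r.
    rewrite ltrBlDl -ltrBlDr lt_max; apply/orP; right; rewrite ltrD2l ltrN2.
    by rewrite ltr_pdivrMr // mulr_natr mulr2n ltrDl.
  have := rf s t as_ (ltW st) tb ts.
  have := ler_norm (f t - f s).
  have : e * (s - a) <= e * (t - a) by rewrite ler_pM2l // lerD2r ltW.
  lra.
Qed.

(** * Almost everywhere primitives *)

#[local] Instance ae_lebesgue_filter (R : realType) :
  Filter (nbhs (almost_everywhere (@lebesgue_measure R))) :=
  ae_filter_ringOfSetsType _.

Lemma is_derive_near_right (R : realType) (F : R -> R) (t l e : R) :
  is_derive t 1 F l -> 0 < e ->
  \forall h \near 0^'+, `|F (t + h) - F t - l * h| <= e * h.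
Proof.
move=> [dF <-] e0; move/cvgrPdist_le: dF => /(_ e e0).
rewrite !near_withinE => -[r /= r0 H]; exists r => // h /= hr h0.
have := H h hr (negbT (gt_eqF h0)).
rewrite -/('D_1 F t) /GRing.scale /= mulr1 (addrC h) => {}H.
have -> : F (t + h) - F t - 'D_1 F t * h =
    - (('D_1 F t - h^-1 * (F (t + h) - F t)) * h).
  by field; rewrite gt_eqF.
by rewrite normrN normrM (gtr0_norm h0) ler_wpM2r // ltW.
Qed.

(** Formulated without an integral: the coordinates of a Caratheodory solution have this form
    directly, and [ac_nonincreasing] needs nothing more. *)
Definition primitive_of (R : realType) (f F : R -> R) : Prop :=
  (forall a b : R, 0 <= a -> a <= b -> absolutely_continuous_on a b F) /\
  {ae @lebesgue_measure R, forall t : R, 0 < t -> is_derive t 1 F (f t)}.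

Lemma primitiveZ (R : realType) (c : R) (f F : R -> R) :
  primitive_of f F -> primitive_of (fun t => c * f t) (fun t => c * F t).
Proof.
move=> [acF dF]; split.
  move=> a b a0 ab; apply: (@ac_dominated _ _ _ _ a b `|c| _ F F); try exact: acF.
  move=> s t _ _ _; rewrite -mulrBr normrM ler_wpM2l // lerDl //.
apply: filterS dF => t dF /dF dFt.
exact: is_deriveZ.
Qed.

Lemma primitiveD (R : realType) (f F g G : R -> R) :
  primitive_of f F -> primitive_of g G ->
  primitive_of (fun t => f t + g t) (fun t => F t + G t).
Proof.
move=> [acF dF] [acG dG]; split.
  move=> a b a0 ab; apply: (@ac_dominated _ _ _ _ a b 1 _ F G).
  - move=> s t _ _ _; rewrite mul1r opprD addrACA; exact: ler_normD.
  - exact: acF.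
  - exact: acG.
apply: filterS2 dF dG => t dF dG t0; apply: is_deriveD; [exact: dF|exact: dG].
Qed.

Lemma primitive_cst (R : realType) (c : R) :
  primitive_of (fun=> 0) (fun=> c).
Proof.
split.
  move=> a b _ _ e e0; exists 1 => // n A B _ _ _.
  by rewrite big1 // => i _; rewrite subrr normr0.
apply: nearW => t _; exact: is_derive_cst.
Qed.

Lemma primitiveB (R : realType) (f F g G : R -> R) :
  primitive_of f F -> primitive_of g G ->
  primitive_of (fun t => f t - g t) (fun t => F t - G t).
Proof.
move=> fF gG; have := primitiveD fF (primitiveZ (-1) gG).
by congr (primitive_of _ _); apply/funext => t; rewrite mulN1r.
Qed.

Lemma primitive_sum (R : realType) (I : finType) (f F : I -> R -> R) :
  (forall i, primitive_of (f i) (F i)) ->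
  primitive_of (fun t => \sum_i f i t) (fun t => \sum_i F i t).
Proof.
move=> fF; elim: (index_enum I) => [|i r IHr].
  have := primitive_cst (0 : R).
  by congr (primitive_of _ _); apply/funext => t; rewrite big_nil.
have := primitiveD (fF i) IHr.
by congr (primitive_of _ _); apply/funext => t; rewrite big_cons.
Qed.

Lemma primitiveM (R : realType) (f F g G : R -> R) :
  primitive_of f F -> primitive_of g G ->
  primitive_of (fun t => f t * G t + F t * g t) (fun t => F t * G t).
Proof.
move=> [acF dF] [acG dG]; split.
  move=> a b a0 ab.
  have [M M0 FM] := ac_bounded ab (acF a b a0 ab).
  have [K K0 GK] := ac_bounded ab (acG a b a0 ab).
  apply: (@ac_dominated _ _ _ _ a b (M + K) _ F G); [|exact: acF|exact: acG].
  move=> s t as_ st tb.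
  (* This splitting bounds the increment of the product by [M] times that of [G] plus [K] times that
     of [F]. *)
  have -> : F t * G t - F s * G s = F t * (G t - G s) + (F t - F s) * G s by ring.
  rewrite (le_trans (ler_normD _ _)) // !normrM.
  have := FM t (le_trans as_ st) tb; have := GK s as_ (le_trans st tb).
  move=> GKs FMt.
  have : `|F t| * `|G t - G s| <= M * `|G t - G s| by rewrite ler_wpM2r.
  have : `|F t - F s| * `|G s| <= `|F t - F s| * K by rewrite ler_wpM2l.
  have : 0 <= M * `|F t - F s| by rewrite mulr_ge0.
  have : 0 <= K * `|G t - G s| by rewrite mulr_ge0.
  lra.
apply: filterS2 dF dG => t dF dG t0.
apply: is_derive_eq; first exact: is_deriveM (dF t0) (dG t0).
by rewrite /GRing.scale /=; ring.
Qed.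

(** Factor out the larger exponential and use [1 + z <= expR z] at [z = y - x]. *)
Lemma expR_lipschitz (R : realType) (M x y : R) : x <= M -> y <= M ->
  `|expR x - expR y| <= expR M * `|x - y|.
Proof.
wlog yx : x y / y <= x => [H xM yM|xM yM].
  have [yx|/ltW xy] := leP y x; first exact: H.
  by rewrite distrC (distrC x); exact: H.
rewrite !ger0_norm ?subr_ge0 ?ler_expR //.
have -> : expR x - expR y = expR x * (1 - expR (y - x)).
  by rewrite mulrBr mulr1 -expRD (addrC x) subrK.
apply: (@le_trans _ _ (expR x * (x - y))).
  rewrite ler_wpM2l ?expR_ge0 //; have := expR_ge1Dx (y - x); lra.
by rewrite ler_wpM2r ?subr_ge0 // ler_expR.
Qed.

Lemma primitive_expR (R : realType) (f F : R -> R) :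
  primitive_of f F ->
  primitive_of (fun t => expR (F t) * f t) (fun t => expR (F t)).
Proof.
move=> [acF dF]; split.
  move=> a b a0 ab; have [M M0 FM] := ac_bounded ab (acF a b a0 ab).
  apply: (@ac_dominated _ _ _ _ a b (expR M) _ F F); try exact: acF.
  move=> s t as_ st tb; apply: (@le_trans _ _ (expR M * `|F t - F s|)).
    apply: expR_lipschitz; apply: (le_trans (ler_norm _)).
      by apply: FM => //; exact: le_trans st.
    by apply: FM => //; exact: le_trans tb.
  by rewrite ler_wpM2l ?expR_ge0 // lerDl.
apply: filterS dF => t dF /dF dFt.
exact: (is_derive1_comp (is_derive_expR (F t)) dFt).
Qed.

(** Since [f] is nonnegative, the right difference quotients of [- F] are eventually at most any
    [e > 0] at almost every point, so [ac_nonincreasing] applies to [- F]. *)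
Lemma primitive_nondecreasing (R : realType) (f F : R -> R) (s t : R) :
  primitive_of f F -> 0 <= s -> s <= t ->
  (forall r, s < r -> r < t -> 0 <= f r) -> F s <= F t.
Proof.
move=> [acF dF] s0 st f0; rewrite -lerN2.
apply: (@ac_nonincreasing _ s t (fun r => - F r)) => //.
  apply: (@ac_dominated _ _ _ _ s t 1 _ F F); try exact: acF.
  by move=> x y _ _ _; rewrite mul1r -opprD normrN lerDl.
apply: filterS dF => r dF sr rt e e0.
have r0 : 0 < r := le_lt_trans s0 sr.
apply: filterS2 (is_derive_near_right (dF r0) e0) (nbhs_right_gt 0) => h + h0.
have : 0 <= f r * h by rewrite mulr_ge0 ?f0 // ltW.
by rewrite ler_norml => ? /andP[? _]; lra.
Qed.

(** * Primitives of the coefficients *)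

(** The real line with the Caratheodory measurable sets of the outer measure generated by interval
    length, that is, the Lebesgue sigma-algebra. *)
Local Notation lebesgue_type R :=
  (caratheodory_type ((@wlength R idfun)^*)%mu).

Lemma completed_measurable_borel (R : realType) (A : set R) :
  measurable (A : set (lebesgue_type R)) ->
  exists B N : set R, [/\ measurable B, measurable N,
    @lebesgue_measure R N = 0%E & B `\` N `<=` A /\ A `<=` B `|` N].
Proof.
move=> mA; have : (completed_algebra_gen (@lebesgue_measure R)).-sigma.-measurable A.
  by rewrite completed_caratheodory_measurable.
rewrite g_sigma_completed_algebra_genE => -[B mB [N0 [N [mN N_0 N0N]] <-]].
by exists B, N; split=> //; split=> [x []|x []]; [left|left|right; exact: N0N].
Qed.

(** Each set where [ratr q < f x] agrees with a Borel set [B q] outside a null set [M q]. Countably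
    many [q] suffice, so resetting [f] to 0 on the union of the [M q] yields [g]. *)
Lemma borel_representative (R : realType) (f : R -> R) :
  measurable_fun [set: lebesgue_type R] (f : lebesgue_type R -> R) ->
  (forall x, 0 <= f x) ->
  exists (g : R -> R) (N : set R), [/\ measurable_fun setT g, measurable N,
    @lebesgue_measure R N = 0%E, (forall x, 0 <= g x <= f x) &
    forall x, ~ N x -> f x = g x].
Proof.
move=> mf f0.
have mfq (q : rat) : measurable ([set x | ratr q < f x] : set (lebesgue_type R)).
  have := mf measurableT _ (measurable_itv `]ratr q, +oo[%R).
  rewrite setTI; congr (measurable _); apply/seteqP.
  by split=> x /=; rewrite in_itv /= andbT.
have /choice[B /choice[M BM]] := fun q => completed_measurable_borel (mfq q).
pose N := \bigcup_q M q.
have mN : measurable N.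
  by apply: bigcupT_measurable_rat => q; case: (BM q).
have N0 : @lebesgue_measure R N = 0%E.
  (* The rationals are enumerated by [pickle]; indices that code no rational contribute the empty
     set. *)
  apply/negligibleP => //; pose M' k := oapp M set0 (unpickle k).
  have NM' : N `<=` \bigcup_k M' k.
    move=> x [q _ Mx]; exists (pickle q); first exact: I.
    rewrite /M' pickleK; exact: Mx.
  apply: (@negligibleS _ (measurableTypeR R) R (@lebesgue_measure R) _ _ NM').
  apply: negligible_bigcup => k; rewrite /M'; case: unpickle => [q|] /=.
    by have [_ mMq Mq0 _] := BM q; apply/negligibleP.
  exact: negligible_set0.
exists (fun x => if x \in N then 0 else f x), N; split=> //.
- apply: (measurability _ (RGenOInfty.measurableE R)) => /=.
  move=> _ [_ [r ->] <-]; rewrite setTI.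
  (* Off [N], a rational [q] separates [r] from [g x] and [B q] detects [q < f x]; on [N], where [g]
     is 0, the condition reads [r < 0]. *)
  rewrite (_ : _ @^-1` _ = (if r < 0 then N else set0) `|`
    \bigcup_(q in [set q : rat | r < ratr q]) (B q `\` N)).
    apply: measurableU; first by case: ifP.
    rewrite bigcup_mkcond; apply: bigcupT_measurable_rat => q; case: ifP => // _.
    by have [mB _ _ _] := BM q; exact: measurableD.
  apply/seteqP; split=> x /=; rewrite in_itv /= andbT.
    case: ifPn => [/set_mem Nx r0|/negP]; first by left; rewrite r0.
    rewrite inE => nNx /rat_in_itvoo[q]; rewrite in_itv /= => /andP[rq qf].
    right; exists q => //; split=> //.
    have [_ _ _ [_ /(_ x qf)[//|Mx]]] := BM q.
    by exfalso; apply: nNx; exists q.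
  move=> [|[q /= rq [Bx nNx]]].
    by case: ifP => // r0 Nx; rewrite mem_set.
  rewrite memNset //; apply: (lt_trans rq).
  have [_ _ _ [+ _]] := BM q; apply; split=> // Mx.
  by apply: nNx; exists q.
- by move=> x; case: ifP; rewrite ?lexx f0.
- by move=> x nNx; rewrite memNset.
Qed.

(** First [f] is exchanged for [g] under the completed measure, then the measure is restricted to
    the Borel sets, for which [g] is measurable. *)
Lemma integral_completed_lebesgue (R : realType) (D N : set R) (f g : R -> R) :
  measurable D -> measurable_fun setT g -> measurable N ->
  @lebesgue_measure R N = 0%E ->
  (forall x, D x -> 0 <= f x) -> (forall x, 0 <= g x) ->
  (forall x, D x -> ~ N x -> f x = g x) ->
  (\int[@completed_lebesgue_measure R]_(x in D) (f x)%:E =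
   \int[@lebesgue_measure R]_(x in D) (g x)%:E)%E.
Proof.
move=> mD mg mN N0 f0 g0 fg.
have mid : measurable_fun [set: lebesgue_type R] (idfun : lebesgue_type R -> measurableTypeR R).
  by move=> _ Y mY; rewrite setTI; exact: sub_caratheodory.
have mDc : measurable (D : set (lebesgue_type R)) by exact: sub_caratheodory.
have mgc : measurable_fun (D : set (lebesgue_type R)) (EFin \o g : lebesgue_type R -> \bar R).
  move=> _ Y mY; apply: sub_caratheodory.
  have mgD : measurable_fun D (EFin \o g).
    by apply/measurable_EFinP; exact: measurable_funS mg.
  exact: mgD.
have aefg : ae_eq (@completed_lebesgue_measure R) D (EFin \o g) (EFin \o f).
  exists N; split=> //; first exact: sub_caratheodory.
  move=> x /= gf; apply: contrapT => nNx; apply: gf => Dx; congr EFin.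
  by rewrite fg.
(* Completeness makes [f] measurable, being almost everywhere equal to [g]. *)
have mfc := ae_measurable_fun completed_lebesgue_measure_is_complete aefg mgc.
transitivity (\int[@completed_lebesgue_measure R]_(x in D) (g x)%:E)%E.
  apply: ge0_ae_eq_integral; [exact: mDc|exact: mfc|exact: mgc| | |exact: ae_eq_sym].
    by move=> x Dx; rewrite lee_fin; exact: f0.
  by move=> x _; rewrite lee_fin.
(* The pushforward along the identity, from the Lebesgue to the Borel sigma-algebra, is the
   restriction to Borel sets, where it agrees with [lebesgue_measure]. *)
pose mu := measure_function_pushforward__canonical__measure_function_Measure
  (@completed_lebesgue_measure R) mid.
transitivity (\int[mu]_(x in D) (g x)%:E)%E; last by apply: eq_measure_integral.
rewrite (ge0_integral_pushforward mid) //.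
  by apply/measurable_EFinP; exact: measurable_funS mg.
by move=> x _; rewrite lee_fin.
Qed.

(** * Translation invariance and integrals as primitives *)

Lemma measurable_translate (R : realType) (c : R) :
  measurable_fun [set: measurableTypeR R]
    ((fun x : R => c + x) : measurableTypeR R -> measurableTypeR R).
Proof.
suff : measurable_fun [set: R] (fun x : R => c + x) by [].
by apply: measurable_funD => //; exact: measurable_cst.
Qed.

(** By uniqueness of Lebesgue measure it suffices to compare the pushforward along the translation
    on intervals []a, b]]. *)
Lemma lebesgue_measure_translate (R : realType) (c : R) (A : set R) :
  measurable A -> @lebesgue_measure R ((fun x => c + x) @^-1` A) = lebesgue_measure A.
Proof.
move=> mA; apply/esym.
pose mu := measure_function_pushforward__canonical__measure_function_Measure
  (@lebesgue_measure R) (measurable_translate c).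
refine (@lebesgue_measure_unique R mu _ A mA) => X /ocitvP[->|].
  by rewrite !measure0.
move=> [[a b] /= ab ->]; rewrite /pushforward.
have -> : (fun x => c + x) @^-1` `]a, b]%classic = `]a - c, b - c]%classic :> set R.
  by apply/seteqP; split=> x /=; rewrite !in_itv /= ltrBlDl lerBrDl.
by rewrite !lebesgue_measure_itv /= !lte_fin ltrD2r ab -!EFinB; congr EFin; ring.
Qed.

Lemma integral_translate (R : realType) (c a b : R) (g : R -> R) :
  measurable_fun setT g -> (forall x, 0 <= g x) ->
  (\int[@lebesgue_measure R]_(x in `[a, b]) (g (c + x))%:E =
   \int[@lebesgue_measure R]_(x in `[(c + a)%R, (c + b)%R]) (g x)%:E)%E.
Proof.
move=> mg g0.
transitivity (\int[measure_function_pushforward__canonical__measure_function_Measure (@lebesgue_measure R) (measurable_translate c)]_(x in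
    `[(c + a)%R, (c + b)%R]) (g x)%:E)%E; last first.
  by apply: eq_measure_integral => A mA _; exact: lebesgue_measure_translate.
rewrite (ge0_integral_pushforward (measurable_translate c)) //.
- congr integral; apply/seteqP.
  by split=> x /=; rewrite !in_itv /= !lerD2l.
- by apply/measurable_EFinP; exact: measurable_funS mg.
- by move=> x _; rewrite lee_fin.
Qed.

Lemma locally_integrable_ge0 (R : realType) (g : R -> R) :
  measurable_fun setT g -> (forall x, 0 <= g x) ->
  (forall a b : R, (\int[@lebesgue_measure R]_(x in `[a, b]) (g x)%:E < +oo)%E) ->
  locally_integrable setT g.
Proof.
move=> mg g0 gfin; split=> // [|K _ cK]; first exact: openT.
have [M [Mr KM]] := compact_bounded cK.
have KMM : K `<=` `[- (M + 1), M + 1]%classic.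
  by move=> x Kx; rewrite /= in_itv /= -ler_norml; apply: (KM (M + 1)) => //; rewrite ltrDl.
apply: le_lt_trans (gfin (- (M + 1)) (M + 1)).
under eq_integral do rewrite ger0_norm //.
apply: ge0_subset_integral => //.
- exact: compact_measurable.
- by apply/measurable_EFinP; exact: measurable_funS mg.
- by move=> x _; rewrite lee_fin.
Qed.

Lemma integrable_itv_ge0 (R : realType) (g : R -> R) (a b : R) :
  measurable_fun setT g -> (forall x, 0 <= g x) ->
  (\int[@lebesgue_measure R]_(x in `[a, b]) (g x)%:E < +oo)%E -> (@lebesgue_measure R).-integrable `[a, b] (EFin \o g).
Proof.
move=> mg g0 gfin; apply/integrableP; split; first by apply/measurable_EFinP; exact: measurable_funS mg.
by under eq_integral do rewrite /= ger0_norm //.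
Qed.

Lemma Rintegral_itv0B (R : realType) (g : R -> R) (a b : R) : 0 <= a -> a <= b ->
  (@lebesgue_measure R).-integrable `[0, b] (EFin \o g) ->
  \int[@lebesgue_measure R]_(x in `[0, b]) g x -
    \int[@lebesgue_measure R]_(x in `[0, a]) g x = \int[@lebesgue_measure R]_(x in `[a, b]) g x.
Proof.
move=> a0 ab gb; rewrite Rintegral_itvB ?bnd_simp //.
rewrite Rintegral_itv_obnd_cbnd //.
by apply: integrableS gb => //; apply: subset_itvr; rewrite bnd_simp.
Qed.

(** The derivative comes from Lebesgue differentiation, absolute continuity from the smallness of
    the integral of [g] over sets of small measure. *)
Lemma primitive_of_integral (R : realType) (g : R -> R) :
  measurable_fun setT g -> (forall x, 0 <= g x) ->
  (forall a b : R, (\int[@lebesgue_measure R]_(x in `[a, b]) (g x)%:E < +oo)%E) ->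
  primitive_of g (fun t => \int[@lebesgue_measure R]_(x in `[0, t]) g x).
Proof.
move=> mg g0 gfin.
have gint a b := integrable_itv_ge0 mg g0 (gfin a b).
split; last first.
  have := @FTC1 R g (BLeft 0) (gint 0) (locally_integrable_ge0 mg g0 gfin).
  apply: filterS => x Fx x0; have [|dF F'x] := Fx; first by rewrite lte_fin.
  by apply: DeriveDef => //; rewrite -derive1E.
move=> a b a0 ab e e0.
(* [g] need not be integrable on the whole line, so it is first cut off outside [[a, b]]. *)
have gab : (@lebesgue_measure R).-integrable setT (EFin \o (g \_ `[a, b])).
  by rewrite -restrict_EFin; apply/integrable_restrict; rewrite ?setTI.
have [d [d0 gd]] := integral_normr_continuous gab e0.
exists d => // n A B AB dAB ABd.
pose D := \big[setU/set0]_(i < n) `]A i, B i[%classic.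
have mD : measurable D by apply: bigsetU_measurable => i _; exact: measurable_itv.
have Dab : D `<=` `[a, b]%classic.
  rewrite /D; elim/big_ind: _ => [//|X Y XU YU|i _]; first by rewrite subUset; split.
  have [aA [_ Bb]] := AB i.
  by apply: subset_itv; rewrite bnd_simp.
have muD : (@lebesgue_measure R D < d%:E)%E.
  rewrite /D measure_bigsetU_ord //; move: ABd; rewrite -lte_fin -sumEFin.
  apply: le_lt_trans; apply: lee_sum => i _.
  suff : (@lebesgue_measure R `]A i, B i[ <= (B i - A i)%:E)%E by [].
  rewrite lebesgue_measure_itv /= lte_fin.
  by case: ifPn => // _; rewrite lee_fin subr_ge0; have [_ []] := AB i.
apply: le_lt_trans (gd D mD muD).
have -> : \int[@lebesgue_measure R]_(x in D) `|(g \_ `[a, b]) x| =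
    \int[@lebesgue_measure R]_(x in D) g x.
  apply: eq_Rintegral => x /set_mem Dx.
  by rewrite patchE mem_set ?ger0_norm //; exact: Dab.
rewrite -lee_fin /Rintegral fineK; last first.
  by apply: integrable_fin_num => //; exact: integrableS (gint a b).
rewrite /D integral_bigsetU_EFin //; last 3 first.
- exact: index_enum_uniq.
- by apply: sub_trivIset dAB.
- by apply/measurable_EFinP; exact: measurable_funS mg.
rewrite -sumEFin; apply: lee_sum => i _; have [aA [ABi Bb]] := AB i.
have A0 : 0 <= A i := le_trans a0 aA.
rewrite Rintegral_itv0B // ger0_norm; last exact: Rintegral_ge0.
rewrite -Rintegral_itv_obnd_cbnd; last first.
  by apply: integrableS (gint (A i) (B i)) => //; exact: subset_itv_oc_cc.
rewrite -Rintegral_itv_bndo_bndc; last first.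
  by apply: integrableS (gint (A i) (B i)) => //; exact: subset_itv_oo_cc.
rewrite /Rintegral fineK //; apply: integrable_fin_num => //.
by apply: integrableS (gint (A i) (B i)) => //; exact: subset_itv_oo_cc.
Qed.

(** The representative is taken of [f] extended by 0 to negative arguments; lying between 0 and this
    extension, [g] vanishes there too. *)
Lemma nneg_locally_integrable_borel (R : realType) (f : R -> R) :
  nneg_locally_integrable f ->
  exists (g : R -> R) (N : set R), [/\ measurable_fun setT g, measurable N,
    @lebesgue_measure R N = 0%E, (forall x, 0 <= g x) /\ (forall x, x < 0 -> g x = 0) &
    forall x, 0 <= x -> ~ N x -> f x = g x].
Proof.
move=> [f0 fint].
have mitv (i : interval R) : measurable ([set` i] : set (lebesgue_type R)).
  by apply: sub_caratheodory; exact: measurable_itv.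
have mf : measurable_fun (`[0, +oo[%classic : set (lebesgue_type R)) (f : lebesgue_type R -> R).
  rewrite itv_bndy_bigcup_BRight; apply/measurable_fun_bigcup => n.
    exact: mitv.
  have n0 : (0 : R) <= 0 + n%:R by rewrite add0r.
  by have /integrableP[/measurable_EFinP] := fint 0 (0 + n%:R) (lexx _) n0.
have := mf; rewrite (measurable_restrictT _ (mitv _)) => /borel_representative[].
  by move=> x; rewrite patchE; case: ifPn => // /set_mem; rewrite /= in_itv /= andbT => /f0.
move=> g [N [mg mN N0 gf fg]]; exists g, N; split=> //.
  split=> x; first by case/andP: (gf x).
  move=> x0; have := gf x; rewrite patchE memNset /=; first by move/le_anti.
  by rewrite in_itv /= andbT leNgt x0.
by move=> x x0 nNx; rewrite -fg // patchE mem_set //= in_itv /= x0.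
Qed.

(** The interface between integrals and the dynamics. The second clause turns weak-star convergence
    into convergence of increments of [F], the third turns a persistent arrow into a strict increase
    of [F] after every positive time. *)
Lemma nneg_locally_integrable_primitive (R : realType) (f : R -> R) :
  nneg_locally_integrable f ->
  exists F : R -> R, [/\ primitive_of f F,
    (forall c a b, 0 <= c -> 0 <= a -> a <= b ->
      \int[@completed_lebesgue_measure R]_(s in `[a, b]) f (c + s) =
      F (c + b) - F (c + a)) &
    (forall t, 0 < t ->
      (0 < \int[@completed_lebesgue_measure R]_(s in `[t, +oo[) (f s)%:E)%E ->
      exists2 b, t < b & F t < F b)].
Proof.
move=> hf; have [g [N [mg mN N0 [g0 gneg] fg]]] := nneg_locally_integrable_borel hf.
have [f0 fint] := hf.
have shift (c a b : R) : 0 <= c -> 0 <= a ->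
    (\int[@completed_lebesgue_measure R]_(s in `[a, b]) (f (c + s)%R)%:E =
     \int[@lebesgue_measure R]_(s in `[(c + a)%R, (c + b)%R]) (g s)%:E)%E.
  move=> c0 a0; rewrite -integral_translate //.
  have mtr := measurable_translate c.
  apply: (@integral_completed_lebesgue _ _ ((fun s => c + s) @^-1` N)
    (fun s => f (c + s)) (fun s => g (c + s))) => //.
  - apply: (measurableT_comp mg); exact: mtr.
  - by rewrite -[_ @^-1` _]setTI; exact: mtr.
  - by rewrite lebesgue_measure_translate.
  - move=> x; rewrite /= in_itv /= => /andP[ax _].
    by apply: f0; rewrite addr_ge0 // (le_trans a0).
  - move=> x; rewrite /= in_itv /= => /andP[ax _].
    by apply: fg; rewrite addr_ge0 // (le_trans a0).
have gfin0 (b : R) : (\int[@lebesgue_measure R]_(x in `[0%R, b]) (g x)%:E < +oo)%E.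
  have [b0|b0] := leP 0 b; last first.
    by rewrite set_itv_ge ?bnd_simp -?ltNge // integral_set0.
  have := shift 0 0 b (lexx _) (lexx _); rewrite !add0r => <-.
  have /integrableP[_] := fint 0 b (lexx _) b0.
  apply: le_lt_trans; rewrite le_eqVlt; apply/orP; left; apply/eqP.
  apply: eq_integral => x /set_mem; rewrite /= in_itv /= add0r => /andP[x0 _].
  by rewrite ger0_norm // f0.
have gfin (a b : R) : (\int[@lebesgue_measure R]_(x in `[a, b]) (g x)%:E < +oo)%E.
  apply: le_lt_trans (gfin0 b).
  have -> : (\int[@lebesgue_measure R]_(x in `[a, b]) (g x)%:E =
      \int[@lebesgue_measure R]_(x in `[a, b] `&` `[0%R, +oo[) (g x)%:E)%E.
    rewrite integral_mkcondr; apply: eq_integral => x _; rewrite patchE.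
    case: ifPn => // /negP; rewrite inE /= in_itv /= andbT => /negP.
    by rewrite -ltNge => /gneg ->.
  apply: ge0_subset_integral => //.
  - exact: measurableI.
  - by apply/measurable_EFinP; exact: measurable_funS mg.
  - by move=> x _; rewrite lee_fin.
  - by move=> x []; rewrite /= !in_itv /= => /andP[_ ->]; rewrite andbT => ->.
have gint (a b : R) := integrable_itv_ge0 mg g0 (gfin a b).
pose F (t : R) : R := \int[@lebesgue_measure R]_(x in `[0, t]) g x.
have [acF dF] : primitive_of g F := primitive_of_integral mg g0 gfin.
exists F; split.
- split=> //; have : {ae @lebesgue_measure R, forall x, ~ N x}.
    by exists N; split=> // x /= nnNx; apply: contrapT => nNx; exact: nnNx.
  apply: filterS2 dF => x dFx nNx x0; rewrite fg //; first exact: dFx.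
  exact: ltW.
- move=> c a b c0 a0 ab; rewrite /F Rintegral_itv0B ?lerD2l ?addr_ge0 //.
  by rewrite /Rintegral shift.
- move=> t t0; rewrite (integral_completed_lebesgue _ mg mN N0) //; last 2 first.
  + by move=> x; rewrite /= in_itv /= andbT => tx; apply: f0; rewrite (le_trans _ tx) // ltW.
  + by move=> x; rewrite /= in_itv /= andbT => tx; apply: fg; rewrite (le_trans _ tx) // ltW.
  (* If [F] never exceeds [F t] after [t], the integral of [g] over each [[t, t + n]] is zero, hence
     by monotone convergence so is the one over [[t, +oo[]. *)
  move=> gt0; apply: contrapT => noF.
  have Fle (b : R) : t < b -> F b <= F t.
    by move=> tb; rewrite leNgt; apply/negP => Ftb; apply: noF; exists b.
  have g_tn (n : nat) : (\int[@lebesgue_measure R]_(x in `[t, (t + n%:R)%R]) (g x)%:E = 0)%E.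
    have tn : t <= t + n%:R by rewrite lerDl.
    have fin : (\int[@lebesgue_measure R]_(x in `[t, (t + n%:R)%R]) (g x)%:E)%E \is a fin_num.
      by apply: integrable_fin_num => //; exact: gint.
    rewrite -(fineK fin); congr EFin.
    have [n0|n0] := leqP n 0.
      have -> : n = 0%N by apply/eqP; rewrite -leqn0.
      rewrite addr0 set_itv1; exact: Rintegral_set1.
    have := Fle (t + n%:R); rewrite ltrDl ltr0n => /(_ n0).
    rewrite -subr_le0 /F Rintegral_itv0B //; last exact: ltW.
    by move=> le0; apply/le_anti; rewrite le0 Rintegral_ge0.
  move: gt0; rewrite itv_bndy_bigcup_BRight.
  have := @ge0_nondecreasing_set_cvg_integral _ (measurableTypeR R) R
    (fun n => `[t, t + n%:R]%classic)
    (EFin \o g) (@lebesgue_measure R).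
  move=> /(_ _ _ _ _)/cvg_lim <- //.
  + by under eq_fun do rewrite /= g_tn; rewrite lim_cst // ltxx.
  + move=> n m nm; apply/subsetPset; apply: subset_itvl; rewrite bnd_simp lerD2l.
    by rewrite ler_nat.
  + by move=> n; apply/measurable_EFinP; exact: measurable_funS mg.
  + by move=> n x _; rewrite lee_fin.
Qed.

(** * Scalar consensus dynamics *)

Lemma ac_max (R : realType) (a b : R) (f g : R -> R) :
  absolutely_continuous_on a b f -> absolutely_continuous_on a b g ->
  absolutely_continuous_on a b (fun t => Num.max (f t) (g t)).
Proof.
apply: (@ac_dominated _ _ _ _ _ _ 1) => s t _ _ _; rewrite mul1r.
have := ler_norm (f t - f s); have := ler_norm (g t - g s).
have := ler_norm (f s - f t); have := ler_norm (g s - g t).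
rewrite (distrC (f s)) (distrC (g s)) ler_norml => ? ? ? ?.
by case: (leP (f t)); case: (leP (f s)); lra.
Qed.

Lemma ac_bigmax (R : realType) (I : finType) (a b C : R) (f : I -> R -> R) :
  (forall i, absolutely_continuous_on a b (f i)) ->
  absolutely_continuous_on a b (fun t => \big[Num.max/C]_i f i t).
Proof.
move=> acf; elim: (index_enum I) => [|i r IHr].
  under eq_fun do rewrite big_nil.
  move=> e e0; exists 1 => // n A B _ _ _.
  by rewrite big1 // => j _; rewrite subrr normr0.
under eq_fun do rewrite big_cons.
exact: ac_max (acf i) IHr.
Qed.

(** The scalar system solved by each coordinate: the coefficients are real, so the coordinates
    decouple. *)
Definition consensus_system (R : realType) (N : nat) (u : 'I_N -> 'I_N -> R -> R)
    (y : 'I_N -> R -> R) : Prop :=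
  forall j, primitive_of (fun t => \sum_k u j k t * (y k t - y j t)) (y j).

(** Maximum principle: [M], the largest of the [y i] and the floor [C], is nonincreasing and equals
    [C] at time [s]. *)
Lemma consensus_system_le (R : realType) (N : nat) (u : 'I_N -> 'I_N -> R -> R)
    (y : 'I_N -> R -> R) (C s t : R) :
  (forall j k r, 0 <= r -> 0 <= u j k r) -> consensus_system u y ->
  0 <= s -> s <= t -> (forall j, y j s <= C) -> forall j, y j t <= C.
Proof.
move=> u0 hy s0 st yC j; pose M r := \big[Num.max/C]_i y i r.
suff MtC : M t <= M s.
  apply: le_trans (le_bigmax _ _ _) (le_trans MtC _).
  by apply: bigmax_le => // i _.
apply: ac_nonincreasing => //.
  by apply: ac_bigmax => i; have [acy _] := hy i; exact: acy.
have : {ae @lebesgue_measure R, forall (r : R) i, 0 < r ->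
    is_derive r 1 (y i) (\sum_k u i k r * (y k r - y i r))}.
  by apply: filter_forall => i; have [] := hy i.
apply: filterS => r dy sr rt e e0; have r0 := le_lt_trans s0 sr.
have yM i : y i r <= M r by exact: le_bigmax.
have : \forall h \near 0^'+, forall i, y i (r + h) <= M r + e * h.
  (* An agent at the maximum has nonpositive derivative; one strictly below it cannot catch up
     within a short time. *)
  apply: filter_forall => i; have [yMi|ltM] := eqVneq (y i r) (M r).
    apply: filterS2 (is_derive_near_right (dy i r0) e0) (nbhs_right_gt 0) => h + h0.
    have : (\sum_k u i k r * (y k r - y i r)) * h <= 0.
      rewrite mulr_le0_ge0 ?(ltW h0) //; apply: sumr_le0 => k _.
      by rewrite mulr_ge0_le0 ?u0 ?(ltW r0) // yMi subr_le0.
    by rewrite ler_norml -yMi => ? /andP[_ ?]; lra.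
  have {}ltM : y i r < M r by rewrite lt_neqAle ltM yM.
  set l := \sum_k u i k r * (y k r - y i r).
  have l1 : 0 < `|l| + 1 by rewrite ltr_wpDl.
  (* Before this much time passes, an agent of slope at most [|l| + 1] stays below [M r]. *)
  have z0 : 0 < (M r - y i r) / (`|l| + 1) by rewrite divr_gt0 // subr_gt0.
  apply: filterS3 (is_derive_near_right (dy i r0) ltr01) (nbhs_right_gt 0)
    (nbhs_right_lt z0) => h + h0.
  rewrite ltr_pdivlMr // mulrDr mulr1 -/l => + hz.
  have : l * h <= h * `|l| by rewrite mulrC ler_wpM2l ?ler_norm // ltW.
  have : 0 < e * h by rewrite mulr_gt0.
  by rewrite ler_norml => ? ? /andP[_ ?]; lra.
apply: filterS2 (nbhs_right_gt 0) => h h0 yMh.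
rewrite lerBlDl; apply: bigmax_le => [|i _]; last exact: yMh.
have : C <= M r by exact: bigmax_ge_id.
have : 0 < e * h by rewrite mulr_gt0.
lra.
Qed.

Lemma consensus_systemZB (R : realType) (N : nat) (u : 'I_N -> 'I_N -> R -> R)
    (y : 'I_N -> R -> R) (a C : R) :
  consensus_system u y -> consensus_system u (fun j t => a * y j t + C).
Proof.
move=> hy j; have := primitiveD (primitiveZ a (hy j)) (primitive_cst C).
congr (primitive_of _ _); apply/funext => t; rewrite addr0 mulr_sumr.
by apply: eq_bigr => k _; ring.
Qed.

(** The function [expR (Phi r) * w j r - a * U j k r] is nondecreasing on [[s, t]]. With [a = 0]
    this bounds the decay of [w j], which carries lower bounds forward in time. *)
Lemma consensus_system_growth (R : realType) (N : nat)
    (u U : 'I_N -> 'I_N -> R -> R) (w : 'I_N -> R -> R) (j k : 'I_N) (a s t : R) :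
  (forall j k r, 0 <= r -> 0 <= u j k r) ->
  (forall j k, primitive_of (u j k) (U j k)) ->
  consensus_system u w -> 0 <= s -> s <= t ->
  (forall i r, s <= r -> 0 <= w i r) ->
  0 <= a -> (forall r, s <= r -> r <= t -> a <= w k r) ->
  w j s + a * (U j k t - U j k s) <=
    expR (\sum_i (U j i t - U j i s)) * w j t.
Proof.
move=> u0 hU hw s0 st w0 a0 aw.
pose Phi r := \sum_i (U j i r - U j i s).
have hPhi : primitive_of (fun r => \sum_i u j i r) Phi.
  apply: primitive_sum => i; have := primitiveB (hU j i) (primitive_cst (U j i s)).
  by congr (primitive_of _ _); apply/funext => r; rewrite subr0.
have hH := primitiveB (primitiveM (primitive_expR hPhi) (hw j)) (primitiveZ a (hU j k)).
have Phis : Phi s = 0 by rewrite /Phi big1 // => i _; rewrite subrr.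
suff : expR (Phi s) * w j s - a * U j k s <= expR (Phi t) * w j t - a * U j k t.
  by rewrite Phis expR0 mul1r /Phi; lra.
apply: (primitive_nondecreasing hH) => // r sr rt.
have r0 : 0 <= r := le_trans s0 (ltW sr).
(* The exponential factor can then be dropped from a nonnegative sum, of which only the [k]-th term
   is kept. *)
have Phi0 : 1 <= expR (Phi r).
  rewrite -expR0 ler_expR sumr_ge0 // => i _; rewrite subr_ge0.
  apply: (primitive_nondecreasing (hU j i)) => //; first exact: ltW.
  by move=> q sq _; rewrite u0 // (le_trans s0) // ltW.
have -> : expR (Phi r) * (\sum_i u j i r) * w j r +
    expR (Phi r) * (\sum_i u j i r * (w i r - w j r)) - a * u j k r =
    expR (Phi r) * (\sum_i u j i r * w i r) - a * u j k r.
  rewrite -mulrA -mulrDr mulr_suml -big_split /=; congr (_ * _ - _).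
  by apply: eq_bigr => i _; ring.
rewrite subr_ge0; apply: (@le_trans _ _ (\sum_i u j i r * w i r)).
  rewrite (bigD1 k) //= mulrC -[leLHS]addr0 lerD //.
    by rewrite ler_wpM2l ?u0 // aw ?ltW.
  by apply: sumr_ge0 => i _; rewrite mulr_ge0 ?u0 ?w0 // ltW.
rewrite ler_peMl //; apply: sumr_ge0 => i _.
by rewrite mulr_ge0 ?u0 ?w0 // ltW.
Qed.

(** * Uniform lower bounds along the sequence [t_] and contraction *)

Lemma cvg_near_ge (R : realType) (f : nat -> R) (l e : R) :
  f n @[n --> \oo] --> l -> e < l -> \forall n \near \oo, e <= f n.
Proof.
move=> fl el; have /cvgrPdist_le := fl => /(_ (l - e)).
rewrite subr_gt0 => /(_ el); apply: filterS => n.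
by rewrite ler_norml => /andP[_ ?]; lra.
Qed.

Lemma cvg_near_le (R : realType) (f : nat -> R) (l e : R) :
  f n @[n --> \oo] --> l -> l < e -> \forall n \near \oo, f n <= e.
Proof.
move=> fl le; have /cvgrPdist_le := fl => /(_ (e - l)).
rewrite subr_gt0 => /(_ le); apply: filterS => n.
by rewrite ler_norml => /andP[? _]; lra.
Qed.

(* Induction along the path: [w k >= c * w l (t_ n)] on a window on which
   [u j k] keeps a positive mass forces [w j] up by the growth estimate, and
   all constants depend only on the limit coefficients. *)
Lemma consensus_system_reach (R : realType) (N : nat)
    (u U V : 'I_N -> 'I_N -> R -> R) (t_ : nat -> R) (e : rel 'I_N) (j l : 'I_N) :
  (forall j k r, 0 <= r -> 0 <= u j k r) ->
  (forall j k, primitive_of (u j k) (U j k)) ->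
  (forall n, 0 <= t_ n) ->
  (forall j k a b, 0 <= a -> a <= b ->
    U j k (t_ n + b) - U j k (t_ n + a) @[n --> \oo] --> V j k b - V j k a) ->
  (forall j k t, e j k -> 0 < t -> exists2 b, t < b & V j k t < V j k b) ->
  connect e j l ->
  exists2 T, 0 < T & forall T', T <= T' -> exists2 c, 0 < c &
    \forall n \near \oo, forall w, consensus_system u w ->
      (forall i r, t_ n <= r -> 0 <= w i r) -> c * w l (t_ n) <= w j (t_ n + T').
Proof.
move=> u0 hU t0 UV eV.
(* The margin 1 in each summand lets the increments of the limit [V] control those of [U] for all
   large [n]. *)
have mass i a b : 0 <= a -> a <= b -> exists2 K, 0 < K &
    \forall n \near \oo, expR (\sum_k (U i k (t_ n + b) - U i k (t_ n + a))) <= K.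
  move=> a0 ab.
  exists (expR (\sum_k (V i k b - V i k a + 1))); first exact: expR_gt0.
  have : \forall n \near \oo, forall k, U i k (t_ n + b) - U i k (t_ n + a) <=
      V i k b - V i k a + 1.
    by apply: filter_forall => k; apply: cvg_near_le (UV i k a b a0 ab) _; rewrite ltrDl.
  by apply: filterS => n hn; rewrite ler_expR ler_sum.
have Umono i k r s : 0 <= r -> r <= s -> U i k r <= U i k s.
  move=> r0 rs; apply: (primitive_nondecreasing (hU i k)) => // q rq _.
  by apply: u0; rewrite (le_trans r0) // ltW.
move=> /connectP[p]; elim: p j => [|k p IHp] j /=.
  (* At the end of the path [j] is [l], and the decay bound alone suffices; the time 1 is an
     arbitrary positive choice. *)
  move=> _ ->; exists 1 => // T T1.
  have T0 : 0 <= T by apply: le_trans T1.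
  have [K K0 hK] := mass j 0 T (lexx _) T0.
  exists K^-1; first by rewrite invr_gt0.
  apply: filterS hK => n hK w hw w0; rewrite mulrC ler_pdivrMr // mulrC.
  have tT : t_ n <= t_ n + T by rewrite lerDl.
  have := consensus_system_growth (k := j) j u0 hU hw (t0 n) tT w0 (lexx 0) (fun r sr _ => w0 j r sr).
  rewrite mul0r addr0 => /le_trans; apply; apply: ler_wpM2r; first exact: w0.
  by rewrite addr0 in hK.
move=> /andP[ejk ekp] lp; have [T T0 hT] := IHp k ekp lp.
have [b Tb Vb] := eV j k T ejk T0.
exists b; first exact: lt_trans Tb.
move=> T' bT'; have TT' : T <= T' by rewrite (le_trans _ bT') // ltW.
have [c c0 hc] := hT T (lexx _).
have [K K0 hK] := mass j T T' (ltW T0) TT'.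
have [L L0 hL] := mass k T T' (ltW T0) TT'.
(* Half of the limit mass on [[T, b]] is a lower bound for the mass of [u j k] there once [n] is
   large. *)
pose m := (V j k b - V j k T) / 2.
have m0 : 0 < m by rewrite divr_gt0 // subr_gt0.
have hm : \forall n \near \oo, m <= U j k (t_ n + b) - U j k (t_ n + T).
  apply: cvg_near_ge (UV j k T b (ltW T0) (ltW Tb)) _.
  by rewrite /m; move: Vb; lra.
(* [c] is the bound for [w k] at time [T], [L] its loss up to [T'], [m] the mass passed to [w j],
   and [K] the damping of [w j]. *)
exists (K^-1 * (m * (L^-1 * c))); first by rewrite mulr_gt0 ?invr_gt0 // mulr_gt0 // mulr_gt0 ?invr_gt0.
near=> n => w hw w0.
have tT r : t_ n + T <= r -> t_ n <= r by apply: le_trans; rewrite lerDl ltW.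
have s0 : 0 <= t_ n + T by rewrite addr_ge0 // ltW.
have ww0 i r : t_ n + T <= r -> 0 <= w i r by move=> /tT; exact: w0.
pose a := L^-1 * (c * w l (t_ n)).
have a0 : 0 <= a by rewrite mulr_ge0 ?invr_ge0 ?(ltW L0) // mulr_ge0 ?(ltW c0) // w0.
have aw r : t_ n + T <= r -> r <= t_ n + T' -> a <= w k r.
  move=> Tr rT'.
  have := consensus_system_growth (k := k) k u0 hU hw s0 Tr ww0 (lexx 0) (fun r sr _ => ww0 k r sr).
  rewrite mul0r addr0 => gr; rewrite /a ler_pdivrMl //.
  have cw : c * w l (t_ n) <= w k (t_ n + T).
    by move: w hw w0 {ww0 a a0 gr}; near: n; exact: hc.
  apply: (le_trans cw); apply: (le_trans gr).
  apply: ler_wpM2r; first exact: ww0.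
  apply: (@le_trans _ _ (expR (\sum_i (U k i (t_ n + T') - U k i (t_ n + T))))).
    rewrite ler_expR; apply: ler_sum => i _; rewrite lerD2r; apply: Umono => //.
    by rewrite (le_trans s0).
  by near: n; exact: hL.
have sT' : t_ n + T <= t_ n + T' by rewrite lerD2l.
have := consensus_system_growth (k := k) j u0 hU hw s0 sT' ww0 a0 aw.
have -> : K^-1 * (m * (L^-1 * c)) * w l (t_ n) = (m * a) / K by rewrite /a; ring.
rewrite ler_pdivrMr // => gr.
have ma : m * a <= a * (U j k (t_ n + T') - U j k (t_ n + T)).
  rewrite mulrC ler_wpM2l //.
  apply: (@le_trans _ _ (U j k (t_ n + b) - U j k (t_ n + T))); first by near: n.
  rewrite lerD2r; apply: Umono; last by rewrite lerD2l.
  by rewrite addr_ge0 // (le_trans (ltW T0)) // ltW.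
have wj0 : 0 <= w j (t_ n + T) by exact: ww0.
have hKn : expR (\sum_i (U j i (t_ n + T') - U j i (t_ n + T))) <= K by near: n.
have : expR (\sum_i (U j i (t_ n + T') - U j i (t_ n + T))) * w j (t_ n + T') <=
    w j (t_ n + T') * K.
  by rewrite mulrC ler_wpM2l // ww0.
lra.
Unshelve. all: by end_near. Qed.

Lemma consensus_system_bounds (R : realType) (N : nat) (u : 'I_N -> 'I_N -> R -> R)
    (y : 'I_N -> R -> R) (lo hi s : R) :
  (forall j k r, 0 <= r -> 0 <= u j k r) -> consensus_system u y -> 0 <= s ->
  (forall j, lo <= y j s <= hi) -> forall j r, s <= r -> lo <= y j r <= hi.
Proof.
move=> u0 hy s0 b j r sr; apply/andP; split.
  have hyN := consensus_systemZB (-1) 0 hy.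
  have := consensus_system_le u0 hyN s0 sr (C := - lo).
  rewrite -lerN2 => /(_ _ j); rewrite mulN1r addr0; apply => i.
  by rewrite mulN1r addr0 lerN2; case/andP: (b i).
by apply: (consensus_system_le u0 hy s0 sr) => i; case/andP: (b i).
Qed.

(** The limit is the supremum of the eventual common lower bounds; evaluating at [i0] shows that
    each of them lies below every eventual upper bound. *)
Lemma cvg_of_shrinking_bounds (R : realType) (I : Type) (i0 : I) (y : I -> R -> R) :
  (forall e, 0 < e -> exists s lo hi : R, hi - lo <= e /\
    forall i r, s <= r -> lo <= y i r <= hi) ->
  exists l : R, forall i, y i t @[t --> +oo] --> l.
Proof.
move=> shrink; pose S := [set lo | exists s : R, forall i r, s <= r -> lo <= y i r].
have Shi (s hi : R) : (forall i r, s <= r -> y i r <= hi) -> ubound S hi.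
  move=> yhi lo [s' ylo]; apply: le_trans (ylo i0 (Num.max s s') _) (yhi _ _ _);
    by rewrite le_max lexx ?orbT.
exists (sup S) => i; apply/cvgrPdist_le => e e0.
have [s [lo [hi [hilo b]]]] := shrink e e0.
have Slo : S lo by exists s => k r sr; case/andP: (b k r sr).
have Sub : ubound S hi by apply: (Shi s) => k r sr; case/andP: (b k r sr).
have lo_sup : lo <= sup S by apply: sup_upper_bound => //; split; [exists lo|exists hi].
have sup_hi : sup S <= hi by apply: ge_sup => //; exists lo.
near=> r; have /andP[? ?] : lo <= y i r <= hi.
  by apply: b; near: r; apply: nbhs_pinfty_ge; exact: num_real.
by rewrite ler_norml; apply/andP; split; lra.
Unshelve. all: by end_near. Qed.

Lemma consensus_system_cvg (R : realType) (N : nat)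
    (u U V : 'I_N -> 'I_N -> R -> R) (t_ : nat -> R) (e : rel 'I_N) (l : 'I_N)
    (y : 'I_N -> R -> R) :
  (forall j k r, 0 <= r -> 0 <= u j k r) ->
  (forall j k, primitive_of (u j k) (U j k)) ->
  (forall n, 0 <= t_ n) -> t_ n @[n --> \oo] --> +oo ->
  (forall j k a b, 0 <= a -> a <= b ->
    U j k (t_ n + b) - U j k (t_ n + a) @[n --> \oo] --> V j k b - V j k a) ->
  (forall j k t, e j k -> 0 < t -> exists2 b, t < b & V j k t < V j k b) ->
  globally_reachable e l -> consensus_system u y ->
  exists ystar : R, forall j, y j t @[t --> +oo] --> ystar.
Proof.
move=> u0 hU t0 too UV eV hl hy.
have /choice[T_ hT_] : forall j, exists T, 0 < T /\ forall T', T <= T' ->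
    exists2 c, 0 < c & \forall n \near \oo, forall w, consensus_system u w ->
      (forall i r, t_ n <= r -> 0 <= w i r) -> c * w l (t_ n) <= w j (t_ n + T').
  move=> j; have [T T0 hT] := consensus_system_reach u0 hU t0 UV eV (hl j).
  by exists T.
(* A common time beyond every [T_ j], allowed because the reachability bound holds at all later
   times. *)
pose T := \sum_j T_ j.
have TT j : T_ j <= T.
  rewrite /T (bigD1 j) //= lerDl sumr_ge0 // => i _.
  by have [/ltW] := hT_ i.
have T0 : 0 <= T by rewrite sumr_ge0 // => i _; have [/ltW] := hT_ i.
have /choice[c_ hc_] : forall j, exists c, 0 < c /\ \forall n \near \oo, forall w,
    consensus_system u w -> (forall i r, t_ n <= r -> 0 <= w i r) ->
    c * w l (t_ n) <= w j (t_ n + T).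
  by move=> j; have [_ /(_ T (TT j))[c c0 hc]] := hT_ j; exists c.
(* The default 1 gives [c <= 1], so that [1 - c] is a contraction factor in [[0, 1[]. *)
pose c := \big[Num.min/1]_j c_ j.
have c0 : 0 < c by apply: lt_bigmin => [|i _]; [exact: ltr01|have [] := hc_ i].
have c1 : c <= 1 by exact: bigmin_le_id.
have hc : \forall n \near \oo, forall j w,
    consensus_system u w -> (forall i r, t_ n <= r -> 0 <= w i r) ->
    c * w l (t_ n) <= w j (t_ n + T).
  apply: filter_forall => j; have [_] := hc_ j; apply: filterS => n hn w hw w0.
  by apply: le_trans (hn w hw w0); rewrite ler_wpM2r ?w0 //; exact: bigmin_le.
apply: (cvg_of_shrinking_bounds l) => z z0.
pose B := \sum_j `|y j 0|.
suff step m : exists s lo hi : R, [/\ 0 <= s, hi - lo <= (1 - c) ^+ m * (B + B) &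
    forall j r, s <= r -> lo <= y j r <= hi].
  have : (1 - c) ^+ m * (B + B) @[m --> \oo] --> 0 * (B + B).
    apply: cvgM; last exact: cvg_cst.
    by apply: cvg_expr; rewrite ger0_norm ?subr_ge0 // ltrBlDr ltrDl.
  rewrite mul0r => /cvg_near_le/(_ z0) /filter_ex[m hm].
  have [s [lo [hi [_ hilo b]]]] := step m.
  by exists s, lo, hi; split=> //; exact: le_trans hm.
elim: m => [|m [s [lo [hi [s0 hilo b]]]]].
  exists 0, (- B), B; split=> //; first by rewrite opprK expr0 mul1r.
  apply: (consensus_system_bounds u0 hy (lexx 0)) => j; rewrite -ler_norml.
  by rewrite /B (bigD1 j) //= lerDl sumr_ge0.
have /filter_ex[n [hn sn]] : \forall n \near \oo, (forall j w,
    consensus_system u w -> (forall i r, t_ n <= r -> 0 <= w i r) ->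
    c * w l (t_ n) <= w j (t_ n + T)) /\ s <= t_ n.
  apply: filterI hc _; exact: (cvgry_ge too).
have bn i r : t_ n <= r -> lo <= y i r <= hi by move=> tr; apply: b; exact: le_trans tr.
pose a := y l (t_ n).
(* The bound applied to [y - lo] and to [hi - y] gives the new endpoints; their gains add up to
   [c * (hi - lo)] whatever the position [a] of [l]. *)
exists (t_ n + T), (lo + c * (a - lo)), (hi - c * (hi - a)).
have tT : 0 <= t_ n + T by rewrite addr_ge0.
split=> //.
  have -> : hi - c * (hi - a) - (lo + c * (a - lo)) = (1 - c) * (hi - lo) by ring.
  by rewrite exprS -mulrA ler_wpM2l // subr_ge0.
apply: (consensus_system_bounds u0 hy tT) => j; apply/andP; split.
  have := hn j _ (consensus_systemZB 1 (- lo) hy).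
  rewrite !mul1r -/a lerBrDl; apply => i r /(bn i)/andP[? _].
  by rewrite mul1r subr_ge0.
have := hn j _ (consensus_systemZB (-1) hi hy).
rewrite !mulN1r -/a (addrC (- a)) => /(_ _); rewrite lerBrDl -lerBrDr.
have nn : forall i r, t_ n <= r -> 0 <= -1 * y i r + hi.
  by move=> i r /(bn i)/andP[_ ?]; rewrite mulN1r addrC subr_ge0.
by move=> /(_ nn); lra.
Qed.

(** * Vector-valued solutions *)

(** The completed measure of [A] is its Lebesgue outer measure, and sets of outer measure zero are
    negligible for [lebesgue_measure]. *)
Lemma ae_completed_lebesgue (R : realType) (P : R -> Prop) :
  {ae @completed_lebesgue_measure R, forall t, P t} ->
  {ae @lebesgue_measure R, forall t, P t}.
Proof.
move=> [A [_ A0 PA]].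
have : (@lebesgue_measure R).-negligible A by apply/negligible_outer_measure; exact: A0.
exact: negligibleS.
Qed.

Lemma ler_coord_norm (R : realType) (d : nat) (x : 'rV[R]_d) (i : 'I_d) :
  `|x ord0 i| <= `|x|.
Proof.
rewrite -[leRHS]/(mx_norm x) mx_normrE.
exact: (le_bigmax _ (fun ij => `|x ij.1 ij.2|) (ord0, i)).
Qed.

Lemma cvg_row (R : realType) (d : nat) (T : Type) (F : set_system T) (FF : Filter F)
    (f : T -> 'rV[R]_d) (l : 'rV[R]_d) :
  (forall i, f t ord0 i @[t --> F] --> l ord0 i) -> f t @[t --> F] --> l.
Proof.
move=> fl; apply/cvgrPdist_le => e e0.
have : \forall t \near F, forall i, `|l ord0 i - f t ord0 i| <= e.
  by apply: filter_forall => i; have /cvgrPdist_le := fl i; exact.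
apply: filterS => t hle; rewrite -[leLHS]/(mx_norm (l - f t)) mx_normrE.
apply: bigmax_le => [|[j i] _ /=]; first exact: ltW.
by rewrite (ord1 j) !mxE.
Qed.

Lemma caratheodory_solution_coord (R : realType) (N d : nat)
    (u : 'I_N -> 'I_N -> R -> R) (x : 'I_N -> R -> 'rV[R]_d) (i : 'I_d) :
  caratheodory_solution u x -> consensus_system u (fun j t => x j t ord0 i).
Proof.
move=> hx j; have [acx /ae_completed_lebesgue dx] := hx j; split.
  move=> a b a0 ab.
  apply: (@ac_dominated _ _ _ _ a b 1 _ (x j) (x j)); try exact: acx.
  move=> s t _ _ _; rewrite mul1r (le_trans _ (ler_wpDr _ (lexx _))) //.
  by have := ler_coord_norm (x j t - x j s) i; rewrite !mxE.
apply: filterS dx => t dx t0; have [drv eqd] := dx t0.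
apply: DeriveDef.
  by move/derivable_mxP : drv; apply.
have := derive_mx drv; rewrite eqd => /matrixP/(_ ord0 i); rewrite !mxE => <-.
rewrite summxE; by apply: eq_bigr => k _; rewrite !mxE.
Qed.

Theorem theorem4 (R : realType) (N d : nat) (hN : (1 <= N)%N) (hd : (1 <= d)%N)
    (u ustar : 'I_N -> 'I_N -> R -> R)
    (hu : forall j k : 'I_N, nneg_locally_integrable (u j k))
    (hustar : forall j k : 'I_N, nneg_locally_integrable (ustar j k))
    (t_ : nat -> R) (ht0 : forall n : nat, 0 <= t_ n)
    (htoo : t_ n @[n --> \oo] --> +oo)
    (hcvg : forall j k : 'I_N,
      weak_star_cvg (fun n s => u j k (t_ n + s)) (ustar j k))
    (hG : exists l : 'I_N, globally_reachable (persistent_graph ustar) l) :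
  forall (x0 : 'I_N -> 'rV[R]_d) (x : 'I_N -> R -> 'rV[R]_d),
    caratheodory_solution u x -> (forall j : 'I_N, x j 0 = x0 j) ->
    converges_to_consensus x.
Proof.
move=> x0 x hx _; have [l hl] := hG.
have /choice[U0 hU0] := fun jk : 'I_N * 'I_N => nneg_locally_integrable_primitive (hu jk.1 jk.2).
have /choice[V0 hV0] := fun jk : 'I_N * 'I_N => nneg_locally_integrable_primitive (hustar jk.1 jk.2).
pose U j k := U0 (j, k); pose V j k := V0 (j, k).
have u0 j k r : 0 <= r -> 0 <= u j k r by have [+ _] := hu j k; exact.
have hU j k : primitive_of (u j k) (U j k) by have [] := hU0 (j, k).
have UV j k (a b : R) : 0 <= a -> a <= b ->
    U j k (t_ n + b) - U j k (t_ n + a) @[n --> \oo] --> V j k b - V j k a.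
  move=> a0 ab; have := hcvg j k a b a0 ab.
  have [_ Ushift _] := hU0 (j, k); have [_ Vshift _] := hV0 (j, k).
  (* The limit integral is the instance with shift 0. *)
  have := Vshift 0 a b (lexx _) a0 ab.
  under eq_Rintegral do rewrite add0r.
  rewrite !add0r /= => ->.
  by under eq_fun do rewrite (Ushift _ _ _ (ht0 _) a0 ab).
have eV j k (t : R) : persistent_graph ustar j k -> 0 < t ->
    exists2 b, t < b & V j k t < V j k b.
  by move=> /asboolP e_jk t0; have [_ _] := hV0 (j, k); apply=> //; exact: e_jk.
have /choice[xstar hxstar] : forall i : 'I_d, exists z : R, forall j,
    x j t ord0 i @[t --> +oo] --> z.
  move=> i; apply: (consensus_system_cvg u0 hU ht0 htoo UV eV hl).
  exact: caratheodory_solution_coord.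
exists (\row_i xstar i) => j; apply: cvg_row => i.
by rewrite mxE; exact: hxstar.
Qed.
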